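(* Let $A\in\mathbb{C}^{m\times n}$ and $\mathbf{b}\in\mathbb{C}^m$ be such that $A\mathbf{x}=\mathbf{b}$ is consistent, assume $\|A\|_F^4\neq\|AA^*\|_F^2$, and let $\mathbf{x}_\star=A^\dagger\mathbf{b}$. Then the iterative sequence $\{\mathbf{x}_k\}$ generated by the two-dimensional randomized Kaczmarz method (described in the context) is convergent to $\mathbf{x}_\star$ for any initial vector $\mathbf{x}_0$. Moreover, its convergence factor $1-\frac{2\|A\|_F^4-2\|A\|_F^2\|A\|_2^2}{\|A\|_F^4-\|AA^*\|_F^2}\frac{\lambda_{\min}(A^*A)}{\|A\|_F^2}$ satisfies $$1-\frac{2\|A\|_F^4-2\|A\|_F^2\|A\|_2^2}{\|A\|_F^4-\|AA^*\|_F^2}\,\frac{\lambda_{\min}(A^*A)}{\|A\|_F^2}<1-\frac{\lambda_{\min}(A^*A)}{\|A\|_F^2},$$ that is, it is strictly smaller than the convergence factor $1-\frac{\lambda_{\min}(A^*A)}{\|A\|_F^2}$ of the randomized Kaczmarz method.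
   Context: Here $A^\dagger$ is the Moore-Penrose pseudoinverse, $\mathbf{a}_i$ is the $i$-th row of $A$ (a row vector), $\mathbf{b}_i$ is the $i$-th entry of $\mathbf{b}$, $(\cdot)^*$ is the conjugate transpose, $\|\cdot\|_F$ is the Frobenius norm, $\|A\|_2$ is the largest singular value, and $\lambda_{\min}(A^*A)$ is the smallest nonzero eigenvalue of $A^*A$. The cross-product-like constant of two row vectors is $|\mathbf{x}\times\mathbf{y}|=\sqrt{\|\mathbf{x}\|_2^2\|\mathbf{y}\|_2^2-|\mathbf{x}\mathbf{y}^*|^2}$. The convergence factor of the two-dimensional randomized Kaczmarz method is the quantity $q$ in the mean-square error bound $\mathbb{E}\|\mathbf{x}_{k+1}-\mathbf{x}_\star\|_2^2\le q^{k+1}\|\mathbf{x}_0-\mathbf{x}_\star\|_2^2$. Convergence for this method is understood, as elsewhere in the paper, in expectation, i.e. $\mathbb{E}\|\mathbf{x}_k-\mathbf{x}_\star\|_2^2\to0$. Two-dimensional randomized Kaczmarz method. Starting from $\mathbf{x}_0\in\mathbb{C}^n$, for $k=0,1,2,\dots$: select (independently of the past) an ordered pair of rows $(i_k,j_k)\in\{1,\dots,m\}^2$ with probability $$\frac{|\mathbf{a}_{i_k}\times\mathbf{a}_{j_k}|^2}{\|A\|_F^4-\|AA^*\|_F^2}$$ (pairs of parallel rows, in particular $i_k=j_k$, have probability $0$), and set $\mathbf{x}_{k+1}=\mathbf{x}_k+\gamma_k\mathbf{a}_{i_k}^*+\lambda_k\mathbf{a}_{j_k}^*$, where $$\gamma_k=\frac{\|\mathbf{a}_{j_k}\|_2^2(\mathbf{b}_{i_k}-\mathbf{a}_{i_k}\mathbf{x}_k)-\mathbf{a}_{i_k}\mathbf{a}_{j_k}^*(\mathbf{b}_{j_k}-\mathbf{a}_{j_k}\mathbf{x}_k)}{\|\mathbf{a}_{i_k}\|_2^2\|\mathbf{a}_{j_k}\|_2^2-|\mathbf{a}_{i_k}\mathbf{a}_{j_k}^*|^2},$$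 $$\lambda_k=\frac{\|\mathbf{a}_{i_k}\|_2^2(\mathbf{b}_{j_k}-\mathbf{a}_{j_k}\mathbf{x}_k)-\mathbf{a}_{j_k}\mathbf{a}_{i_k}^*(\mathbf{b}_{i_k}-\mathbf{a}_{i_k}\mathbf{x}_k)}{\|\mathbf{a}_{i_k}\|_2^2\|\mathbf{a}_{j_k}\|_2^2-|\mathbf{a}_{i_k}\mathbf{a}_{j_k}^*|^2}.$$
   Formalization: Convergence to x⋆ for any x0 fails when x0 has a component in ker A (it never changes), so convergence to x⋆ is stated for x0 in range(A* ), and for arbitrary x0 the limit is x⋆+(I−A†A)x0 with the same factor. *)

(* Defs.v *)
From HB Require Import structures.
From mathcomp Require Import all_boot all_order all_algebra.
From mathcomp Require Import complex.
From mathcomp Require Import all_classical all_reals all_analysis.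

Set Implicit Arguments.
Unset Strict Implicit.
Unset Printing Implicit Defensive.

Import Order.TTheory GRing.Theory Num.Theory.
Import numFieldNormedType.Exports.

Local Open Scope classical_set_scope.
Local Open Scope ring_scope.
Local Open Scope complex_scope.
Local Open Scope sesquilinear_scope.

Section Norms.
Variable R : realType.

(* On row and column vectors this is the Euclidean norm. *)
Definition normF m n (A : 'M[R[i]]_(m, n)) : R :=
  Num.sqrt (\sum_i \sum_j Normc.normc (A i j) ^+ 2).

Definition inner n (x y : 'rV[R[i]]_n) : R[i] := (x *m y^t*) 0 0.

Definition cross n (x y : 'rV[R[i]]_n) : R :=
  Num.sqrt (normF x ^+ 2 * normF y ^+ 2 - Normc.normc (inner x y) ^+ 2).

Definition singular_values m n (A : 'M[R[i]]_(m, n)) : set R :=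
  [set s | 0 <= s /\ eigenvalue (A^t* *m A) (s ^+ 2)%:C].

(* The spectrum of A^* A is real and finite, so the sup and inf below are a
   maximum and a minimum, provided n > 0 and A != 0 respectively. *)
Definition norm2 m n (A : 'M[R[i]]_(m, n)) : R := sup (singular_values A).

Definition lambda_min m n (A : 'M[R[i]]_(m, n)) : R :=
  inf [set l : R | l != 0 /\ eigenvalue (A^t* *m A) l%:C].

(* The four Penrose equations, which determine Adag uniquely. *)
Definition is_pseudoinverse m n (A : 'M[R[i]]_(m, n)) (Adag : 'M[R[i]]_(n, m)) :=
  [/\ A *m Adag *m A = A,
      Adag *m A *m Adag = Adag,
      (A *m Adag)^t* = A *m Adag &
      (Adag *m A)^t* = Adag *m A].

End Norms.

Section Kaczmarz.
Variables (R : realType) (m n : nat) (A : 'M[R[i]]_(m, n)) (b : 'cV[R[i]]_m).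

Definition rk2_prob (p : 'I_m * 'I_m) : R :=
  cross (row p.1 A) (row p.2 A) ^+ 2 /
  (normF A ^+ 4 - normF (A *m A^t*) ^+ 2).

Definition residual (i : 'I_m) (x : 'cV[R[i]]_n) : R[i] :=
  b i 0 - (row i A *m x) 0 0.

(* Coefficient of the row i in the update from x with the rows i and j.
   gamma_k is rk2_coef i_k j_k x_k, and lambda_k is rk2_coef j_k i_k x_k.
   The denominator vanishes only for pairs of probability 0. *)
Definition rk2_coef (i j : 'I_m) (x : 'cV[R[i]]_n) : R[i] :=
  ((normF (row j A) ^+ 2)%:C * residual i x
     - inner (row i A) (row j A) * residual j x) /
  (normF (row i A) ^+ 2 * normF (row j A) ^+ 2
     - Normc.normc (inner (row i A) (row j A)) ^+ 2)%:C.

Definition rk2_step (p : 'I_m * 'I_m) (x : 'cV[R[i]]_n) : 'cV[R[i]]_n :=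
  x + rk2_coef p.1 p.2 x *: (row p.1 A)^t* + rk2_coef p.2 p.1 x *: (row p.2 A)^t*.

Fixpoint rk2_iter (x0 : 'cV[R[i]]_n) (s : nat -> 'I_m * 'I_m) (k : nat) :
    'cV[R[i]]_n :=
  if k is k'.+1 then rk2_step (s k') (rk2_iter x0 s k') else x0.

Definition rk_factor : R := 1 - lambda_min A / normF A ^+ 2.

Definition rk2_factor : R :=
  1 - (2 * normF A ^+ 4 - 2 * normF A ^+ 2 * norm2 A ^+ 2) /
      (normF A ^+ 4 - normF (A *m A^t*) ^+ 2) *
      (lambda_min A / normF A ^+ 2).

Section Sampling.
Variables (d : measure_display) (T : measurableType d) (P : probability T R).
Variable S : nat -> T -> 'I_m * 'I_m.

(* Mutual independence of random elements of a finite set, by the product rule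
   over every finite subfamily. *)
Definition mutually_independent : Prop :=
  forall (J : seq nat) (B : nat -> set ('I_m * 'I_m)), uniq J ->
    P (\bigcap_(k in [set` J]) (S k @^-1` B k)) =
    (\prod_(k <- J) P (S k @^-1` B k))%E.

(* S k is the ordered pair (i_k, j_k). *)
Definition rk2_sampling : Prop :=
  [/\ forall k p, measurable (S k @^-1` [set p]),
      forall k p, P (S k @^-1` [set p]) = (rk2_prob p)%:E &
      mutually_independent].

Definition mean_square_error (x0 z : 'cV[R[i]]_n) (k : nat) : \bar R :=
  ('E_P[(fun w => normF (rk2_iter x0 (S ^~ w) k - z) ^+ 2)%R])%E.

Definition mean_square_bound (q : R) (x0 z : 'cV[R[i]]_n) : Prop :=
  forall k, (mean_square_error x0 z k.+1 <=
             (q ^+ k.+1 * normF (x0 - z) ^+ 2)%:E)%E.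

Definition mean_square_cvg (x0 z : 'cV[R[i]]_n) : Prop :=
  mean_square_error x0 z k @[k --> \oo] --> 0%E.

End Sampling.
End Kaczmarz.

(* Main.v *)
Require Import Defs.
From HB Require Import structures.
From mathcomp Require Import all_boot all_order all_algebra.
From mathcomp Require Import complex.
From mathcomp Require Import all_classical all_reals all_analysis.
From mathcomp Require Import measurable_realfun ring lra.

Set Implicit Arguments.
Unset Strict Implicit.
Unset Printing Implicit Defensive.

Import Order.TTheory GRing.Theory Num.Theory.
Import numFieldNormedType.Exports.

Local Open Scope classical_set_scope.
Local Open Scope ring_scope.
Local Open Scope complex_scope.
Local Open Scope sesquilinear_scope.

(* One step from x replaces the error e = x - z, where A z = b, by its component
   orthogonal to the rows a_i and a_j.  Weighted by the squared cross product
   (the Gram determinant of the two rows), the decrease of |e|^2 is quadratic in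
   A e, and summing over all pairs gives, with D = |A|_F^4 - |A A^*|_F^2,

     E |e'|^2 = |e|^2 - (2 |A|_F^2 |A e|^2 - 2 |A^* A e|^2) / D.

   In an orthonormal eigenbasis of A^* A, an error in the range of A^* satisfies
   |A^* A e|^2 <= |A|_2^2 |A e|^2 and |A e|^2 >= lambda_min |e|^2, which gives the
   contraction by the factor; the range of A^* is preserved by the steps.
   Independence of the choices turns the mean-square error into the k-th iterate
   of the one-step averaging operator. *)

(** * Hermitian inner products, Gram determinants and projection off a pair of vectors *)

Section ComplexDot.
Variable C : numClosedFieldType.
Implicit Type n : nat.

Definition dotc n (x y : 'cV[C]_n) : C := (x^t* *m y) 0 0.

Lemma dotcC n (x y : 'cV[C]_n) : dotc x y = Num.conj (dotc y x).
Proof.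
rewrite /dotc !mxE rmorph_sum; apply: eq_bigr => i _.
by rewrite !mxE rmorphM /= conjCK mulrC.
Qed.

Lemma dotcDr n (x y z : 'cV[C]_n) : dotc x (y + z) = dotc x y + dotc x z.
Proof. by rewrite /dotc mulmxDr mxE. Qed.

Lemma dotcZr n a (x y : 'cV[C]_n) : dotc x (a *: y) = a * dotc x y.
Proof. by rewrite /dotc -scalemxAr mxE. Qed.

Lemma dotcDl n (x y z : 'cV[C]_n) : dotc (x + y) z = dotc x z + dotc y z.
Proof. by rewrite dotcC dotcDr rmorphD /= -!dotcC. Qed.

Lemma dotcZl n a (x y : 'cV[C]_n) : dotc (a *: x) y = Num.conj a * dotc x y.
Proof. by rewrite dotcC dotcZr rmorphM /= -dotcC. Qed.

Lemma dotc_ge0 n (x : 'cV[C]_n) : 0 <= dotc x x.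
Proof.
rewrite /dotc mxE sumr_ge0 // => i _.
by rewrite !mxE mulrC mul_conjC_ge0.
Qed.

Lemma dotc_eq0 n (x : 'cV[C]_n) : dotc x x = 0 -> x = 0.
Proof.
have xx_ge0 i : 0 <= (x^t*) 0 i * x i 0
  by rewrite !mxE mulrC mul_conjC_ge0.
rewrite /dotc mxE => /psumr_eq0P x0; apply/matrixP => i j; rewrite ord1 mxE.
have := x0 (fun i _ => xx_ge0 i) i isT; rewrite !mxE mulrC => /eqP.
by rewrite mul_conjC_eq0 => /eqP.
Qed.

(* The orthogonal component |y|^2 x - <y,x> y has norm squared |y|^2 times the
   Gram determinant. *)
Lemma gram_ge0 n (x y : 'cV[C]_n) :
  0 <= dotc x x * dotc y y - dotc x y * dotc y x.
Proof.
have := dotc_ge0 (dotc y y *: x - dotc y x *: y).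
rewrite -scaleNr !(dotcDl, dotcDr, dotcZl, dotcZr) !(rmorphN, rmorphM) /= -!dotcC.
have := dotc_ge0 y; rewrite le_eqVlt => /orP[/eqP y0 _|y0].
  have /esym/dotc_eq0 -> := y0.
  by rewrite /dotc !mulmx0 !mxE mulr0 mul0r subr0.
move=> d0; rewrite -(pmulr_rge0 _ y0).
by apply: le_trans d0 _; rewrite le_eqVlt; apply/orP; left; apply/eqP; ring.
Qed.

Lemma gramC n (x y : 'cV[C]_n) :
  dotc x x * dotc y y - dotc x y * dotc y x =
  dotc y y * dotc x x - dotc y x * dotc x y.
Proof. by rewrite mulrC [dotc x y * _]mulrC. Qed.

(** Equality case of Cauchy-Schwarz: the difference of the two sides has norm squared |y|^2 times
    the Gram determinant. *)
Lemma gram_eq0 n (x y : 'cV[C]_n) :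
  dotc x x * dotc y y - dotc x y * dotc y x = 0 ->
  dotc y y *: x = dotc y x *: y.
Proof.
move=> xy0; apply/eqP; rewrite -subr_eq0; apply/eqP/dotc_eq0.
rewrite -scaleNr !(dotcDl, dotcDr, dotcZl, dotcZr) !(rmorphN, rmorphM) /= -!dotcC.
rewrite -[RHS](mulr0 (dotc y y)) -xy0; ring.
Qed.

(** For parallel [x] and [y] the quadratic form that a projection step subtracts degenerates. This
    later covers pairs of parallel rows. *)
Lemma gram_residual_eq0 n (x y e : 'cV[C]_n) :
  dotc x x * dotc y y - dotc x y * dotc y x = 0 ->
  dotc y y * (dotc x e * dotc e x) + dotc x x * (dotc y e * dotc e y)
    - dotc x y * (dotc y e * dotc e x) - dotc y x * (dotc x e * dotc e y) = 0.
Proof.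
have [-> _|/eqP y0 xy0] := y =P 0.
  by rewrite /dotc trmx0 map_mx0 !mul0mx !mulmx0 !mxE; ring.
have yy0 : dotc y y != 0 by apply: contra y0 => /eqP/dotc_eq0/eqP.
have xE : x = (dotc y x / dotc y y) *: y.
  by rewrite mulrC -scalerA -gram_eq0 // scalerA mulVf // scale1r.
set t := _ / _ in xE; rewrite xE !(dotcZl, dotcZr); ring.
Qed.

(** By Cramer's rule, [g] and [l] solve the two linear equations that make the new error orthogonal
    to [x] and [y]. *)
Lemma gram_projection n (x y e : 'cV[C]_n) :
  let D := dotc x x * dotc y y - dotc x y * dotc y x in
  let g := (dotc y y * - dotc x e - dotc x y * - dotc y e) / D in
  let l := (dotc x x * - dotc y e - dotc y x * - dotc x e) / D in
  D != 0 ->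
  D * dotc (e + g *: x + l *: y) (e + g *: x + l *: y) =
  D * dotc e e
  - (dotc y y * (dotc x e * dotc e x) + dotc x x * (dotc y e * dotc e y)
     - dotc x y * (dotc y e * dotc e x) - dotc y x * (dotc x e * dotc e y)).
Proof.
move=> D g l D0.
have DJ : Num.conj D = D.
  by rewrite rmorphB !rmorphM /= -!dotcC [dotc y x * _]mulrC.
have gJ : Num.conj g = (dotc y y * - dotc e x - dotc y x * - dotc e y) / D.
  by rewrite fmorph_div /= DJ rmorphB !rmorphM !rmorphN /= -!dotcC.
have lJ : Num.conj l = (dotc x x * - dotc e y - dotc x y * - dotc e x) / D.
  by rewrite fmorph_div /= DJ rmorphB !rmorphM !rmorphN /= -!dotcC.
rewrite !(dotcDl, dotcDr, dotcZl, dotcZr) gJ lJ {gJ lJ DJ} /g /l {g l}.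
move: D0; rewrite {}/D.
(* The nine inner products become independent variables, which leaves a rational identity. *)
move: (dotc e e) (dotc x x) (dotc y y) (dotc x y) (dotc y x).
move: (dotc x e) (dotc y e) (dotc e x) (dotc e y) => u v u' v' ee p q r s D0.
by field.
Qed.

End ComplexDot.

(** * Frobenius norms as traces and inner products *)

Section SquaredNorm.
Variable R : realType.
Local Notation C := R[i].

Lemma normc_sqrE (z : C) : (Normc.normc z ^+ 2)%:C = z * Num.conj z.
Proof. by rewrite rmorphXn -normCK. Qed.

Lemma normF_sqr m n (A : 'M[C]_(m, n)) :
  normF A ^+ 2 = \sum_i \sum_j Normc.normc (A i j) ^+ 2.
Proof.
rewrite sqr_sqrtr // sumr_ge0 // => i _.
by rewrite sumr_ge0 // => j _; rewrite sqr_ge0.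
Qed.

Lemma normF_trace m n (A : 'M[C]_(m, n)) :
  (normF A ^+ 2)%:C = \tr (A^t* *m A).
Proof.
rewrite normF_sqr exchange_big rmorph_sum; apply: eq_bigr => j _.
rewrite rmorph_sum mxE; apply: eq_bigr => i _ /=.
by rewrite normc_sqrE !mxE mulrC.
Qed.

Lemma normF_adjoint m n (A : 'M[C]_(m, n)) : normF (A^t*) ^+ 2 = normF A ^+ 2.
Proof. by apply: complexI; rewrite !normF_trace trmxCK mxtrace_mulC. Qed.

Lemma normF_eq0 m n (A : 'M[C]_(m, n)) : normF A ^+ 2 = 0 -> A = 0.
Proof.
rewrite normF_sqr => A0; apply/matrixP => i j; rewrite mxE.
have /psumr_eq0P := A0; move=> /(_ _ i isT) h.
have /psumr_eq0P := h (fun i _ => sumr_ge0 _ (fun j _ => sqr_ge0 _)).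
move=> /(_ (fun j _ => sqr_ge0 _) j isT) /eqP.
by rewrite sqrf_eq0 => /eqP; exact: Normc.eq0_normc.
Qed.

Lemma dotcE n (x : 'cV[C]_n) : (normF x ^+ 2)%:C = dotc x x.
Proof. by rewrite normF_trace /mxtrace big_ord1. Qed.

End SquaredNorm.

(** * One step with a fixed pair of rows *)

Section OneStep.
Variables (R : realType) (m n : nat) (A : 'M[R[i]]_(m, n)).
Variables (b : 'cV[R[i]]_m) (x z : 'cV[R[i]]_n).
Hypothesis Az : A *m z = b.
Local Notation C := R[i].
Local Notation a i := ((row i A)^t*).
Local Notation gram i j :=
  (dotc (a i) (a i) * dotc (a j) (a j) - dotc (a i) (a j) * dotc (a j) (a i)).

Lemma normF_row i : (normF (row i A) ^+ 2)%:C = dotc (a i) (a i).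
Proof. by rewrite -normF_adjoint dotcE. Qed.

Lemma inner_row i j : inner (row i A) (row j A) = dotc (a i) (a j).
Proof. by rewrite /dotc trmxCK. Qed.

Lemma gram_row i j :
  (normF (row i A) ^+ 2 * normF (row j A) ^+ 2
     - Normc.normc (inner (row i A) (row j A)) ^+ 2)%:C = gram i j.
Proof.
by rewrite rmorphB rmorphM /= !normF_row normc_sqrE inner_row -dotcC.
Qed.

Lemma cross_sqr i j : (cross (row i A) (row j A) ^+ 2)%:C = gram i j.
Proof.
rewrite -gram_row /cross sqr_sqrtr // -ler0c gram_row; exact: gram_ge0.
Qed.

Lemma residual_dotc i : residual A b i x = - dotc (a i) (x - z).
Proof. by rewrite /residual -Az /dotc trmxCK mulmxBr -!row_mul !mxE opprB. Qed.

Lemma cross_rk2_step i j (e := x - z) :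
  (cross (row i A) (row j A) ^+ 2 * normF (rk2_step A b (i, j) x - z) ^+ 2)%:C =
  gram i j * dotc e e
  - (dotc (a j) (a j) * (dotc (a i) e * dotc e (a i))
     + dotc (a i) (a i) * (dotc (a j) e * dotc e (a j))
     - dotc (a i) (a j) * (dotc (a j) e * dotc e (a i))
     - dotc (a j) (a i) * (dotc (a i) e * dotc e (a j))).
Proof.
rewrite rmorphM /= cross_sqr.
(* For parallel rows both sides vanish: the weight is zero, whatever the coefficients with zero
   denominator give. *)
have [/eqP g0|g0] := boolP (gram i j == 0).
  by rewrite g0 !mul0r gram_residual_eq0 // subr0.
rewrite dotcE /rk2_step /=.
have -> : x + rk2_coef A b i j x *: a i + rk2_coef A b j i x *: a j - z =
    e + rk2_coef A b i j x *: a i + rk2_coef A b j i x *: a j.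
  by rewrite addrAC [X in X + _]addrAC.
rewrite -(gram_projection _ g0).
(* The coefficient of row [j] has the denominator with the two rows exchanged. *)
have gji := gram_row j i; rewrite gramC in gji.
rewrite /rk2_coef (gram_row i j) gji.
by rewrite !inner_row !normF_row !residual_dotc.
Qed.

End OneStep.

(** Exchanging the summation indices identifies the two mixed sums; the other two factor into
    products of single sums. *)
Lemma sum_pairs (K : comNzRingType) m (p q : 'I_m -> K) (G W : 'I_m -> 'I_m -> K) :
  \sum_i \sum_j (p j * q i + p i * q j - G i j * W j i - G j i * W i j) =
  2 * (\sum_i p i) * (\sum_i q i) - 2 * \sum_i \sum_j G i j * W j i.
Proof.
under eq_bigr do rewrite 2!sumrB big_split /= -mulr_suml -mulr_sumr.
rewrite !sumrB big_split /= -mulr_sumr -mulr_suml.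
rewrite [X in _ - X]exchange_big /=; ring.
Qed.

(** * Averaging one step over all pairs of rows *)

Section Average.
Variables (R : realType) (m n : nat) (A : 'M[R[i]]_(m, n)).
Local Notation C := R[i].
Local Notation a i := ((row i A)^t*).
Local Notation D := (normF A ^+ 4 - normF (A *m A^t*) ^+ 2).

Lemma dotc_row i (x : 'cV[C]_n) : dotc (a i) x = (A *m x) i 0.
Proof. by rewrite /dotc trmxCK -row_mul mxE. Qed.

Lemma dotc_rows i j : dotc (a i) (a j) = (A *m A^t*) i j.
Proof. by rewrite dotc_row !mxE; apply: eq_bigr => k _; rewrite !mxE. Qed.

Lemma sum_dotc_row : \sum_i dotc (a i) (a i) = (normF A ^+ 2)%:C.
Proof.
rewrite -normF_adjoint normF_trace trmxCK.
by apply: eq_bigr => i _; rewrite dotc_rows.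
Qed.

Lemma normF_gram :
  (normF (A *m A^t*) ^+ 2)%:C =
  \sum_i \sum_j dotc (a i) (a j) * dotc (a j) (a i).
Proof.
rewrite normF_sqr rmorph_sum; apply: eq_bigr => i _.
rewrite rmorph_sum; apply: eq_bigr => j _ /=.
by rewrite normc_sqrE -dotc_rows -dotcC.
Qed.

Lemma normF_mul (e : 'cV[C]_n) :
  (normF (A *m e) ^+ 2)%:C = \sum_i dotc (a i) e * dotc e (a i).
Proof.
rewrite normF_sqr rmorph_sum; apply: eq_bigr => i _.
by rewrite big_ord1 /= normc_sqrE -dotc_row -dotcC.
Qed.

(** With u = A e, the left side is u^* A A^* u, and the entries of A A^* are the inner products of
    the rows. *)
Lemma normF_gram_mul (e : 'cV[C]_n) :
  (normF (A^t* *m A *m e) ^+ 2)%:C =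
  \sum_i \sum_j dotc (a i) (a j) * (dotc (a j) e * dotc e (a i)).
Proof.
rewrite dotcE -mulmxA [LHS]/dotc trmx_mul map_mxM trmxCK -mulmxA.
rewrite [A *m (_ *m _)]mulmxA mxE.
apply: eq_bigr => i _; rewrite [(A *m A^t* *m _) _ _]mxE mulr_sumr.
apply: eq_bigr => j _; rewrite [dotc e _]dotcC dotc_rows !dotc_row.
by rewrite mulrCA [X in _ * X]mulrC; congr (_ * (_ * _)); rewrite !mxE.
Qed.

(** The products of squared row norms add up to |A|_F^4 and the mixed products to |A A^*|_F^2. As a
    sum of squares, [D] is positive once it is nonzero. *)
Lemma sum_cross :
  \sum_(p : 'I_m * 'I_m) cross (row p.1 A) (row p.2 A) ^+ 2 = D.
Proof.
apply: complexI; rewrite rmorph_sum.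
under eq_bigr do rewrite /= cross_sqr.
rewrite -(pair_bigA _ (fun i j => dotc (a i) (a i) * dotc (a j) (a j)
  - dotc (a i) (a j) * dotc (a j) (a i))) /=.
under eq_bigr do rewrite sumrB -mulr_sumr sum_dotc_row.
rewrite sumrB -mulr_suml sum_dotc_row -normF_gram rmorphB -rmorphM.
by rewrite -expr2 -exprM.
Qed.

Variables (b : 'cV[C]_m) (x z : 'cV[C]_n).
Hypothesis Az : A *m z = b.
Hypothesis D_neq0 : D != 0.

Lemma sum_cross_rk2_step (e := x - z) :
  \sum_(p : 'I_m * 'I_m)
    cross (row p.1 A) (row p.2 A) ^+ 2 * normF (rk2_step A b p x - z) ^+ 2 =
  D * normF e ^+ 2
  - (2 * normF A ^+ 2 * normF (A *m e) ^+ 2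
     - 2 * normF (A^t* *m A *m e) ^+ 2).
Proof.
pose N i j := dotc (a j) (a j) * (dotc (a i) e * dotc e (a i))
     + dotc (a i) (a i) * (dotc (a j) e * dotc e (a j))
     - dotc (a i) (a j) * (dotc (a j) e * dotc e (a i))
     - dotc (a j) (a i) * (dotc (a i) e * dotc e (a j)).
have sumN : \sum_i \sum_j N i j = (2 * normF A ^+ 2 * normF (A *m e) ^+ 2
     - 2 * normF (A^t* *m A *m e) ^+ 2)%:C.
  rewrite (sum_pairs (fun i => dotc (a i) (a i))
    (fun i => dotc (a i) e * dotc e (a i)) (fun i j => dotc (a i) (a j))
    (fun i j => dotc (a i) e * dotc e (a j))).
  rewrite -normF_gram_mul sum_dotc_row -normF_mul.
  by rewrite rmorphB !rmorphM rmorph_nat.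
apply: complexI; rewrite [RHS]rmorphB /= -sumN [in RHS]rmorphM /=.
rewrite -sum_cross !rmorph_sum /= dotcE mulr_suml.
rewrite (pair_bigA _ N) -sumrB; apply: eq_bigr => -[i j] _.
by rewrite (cross_rk2_step x Az) cross_sqr.
Qed.

Lemma mean_rk2_step (e := x - z) :
  \sum_p rk2_prob A p * normF (rk2_step A b p x - z) ^+ 2 =
  normF e ^+ 2
  - (2 * normF A ^+ 2 * normF (A *m e) ^+ 2
     - 2 * normF (A^t* *m A *m e) ^+ 2) / D.
Proof.
under eq_bigr do rewrite /rk2_prob mulrAC.
by rewrite -mulr_suml sum_cross_rk2_step mulrBl mulrAC divff // mul1r.
Qed.

End Average.

(** * The orthonormal eigenbasis of A^* A *)

Section Diagonalization.
Variables (C : numClosedFieldType) (m n : nat) (A : 'M[C]_(m, n)).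

Lemma dotc_adjoint p q (M : 'M[C]_(p, q)) x y :
  dotc (M *m x) y = dotc x (M^t* *m y).
Proof. by rewrite /dotc trmx_mul map_mxM mulmxA. Qed.

Lemma dotc_unitary (Q : 'M[C]_n) x y :
  Q \is unitarymx -> dotc (Q *m x) (Q *m y) = dotc x y.
Proof.
by move=> Qu; rewrite dotc_adjoint mulmxA -[Q^t*]mul1mx mulmxKtV ?mul1mx.
Qed.

Lemma dotc_sum (x y : 'cV[C]_n) : dotc x y = \sum_i Num.conj (x i 0) * y i 0.
Proof. by rewrite /dotc mxE; apply: eq_bigr => i _; rewrite !mxE. Qed.

Lemma diag_mulE (s : 'rV[C]_n) (x : 'cV_n) i :
  (diag_mx s *m x) i 0 = s 0 i * x i 0.
Proof. by rewrite mul_diag_mx mxE. Qed.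

Variables (Q : 'M[C]_n) (s : 'rV[C]_n).
Hypothesis Qu : Q \is unitarymx.
Hypothesis AE : A^t* *m A = Q^t* *m diag_mx s *m Q.

Lemma dotc_mul_diag (e : 'cV[C]_n) :
  dotc (A *m e) (A *m e) =
  \sum_i s 0 i * (Num.conj ((Q *m e) i 0) * (Q *m e) i 0).
Proof.
rewrite dotc_adjoint mulmxA AE -!mulmxA -dotc_adjoint dotc_sum.
by apply: eq_bigr => i _; rewrite diag_mulE mulrCA.
Qed.

(** [s 0 i] is |A q|^2 for the unit eigenvector q, the image under Q^* of the i-th basis vector. *)
Lemma diag_ge0 i : 0 <= s 0 i.
Proof.
have := dotc_ge0 (A *m (Q^t* *m delta_mx i 0)).
rewrite dotc_mul_diag mulmxA (unitarymxP Qu) mul1mx (bigD1 i) //= big1 => [|j ji].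
  by rewrite !mxE !eqxx conjC1 !mulr1 addr0.
by rewrite !mxE (negPf ji) mulr0 mulr0.
Qed.

Lemma dotc_gram_diag (e : 'cV[C]_n) :
  dotc (A^t* *m A *m e) (A^t* *m A *m e) =
  \sum_i s 0 i ^+ 2 * (Num.conj ((Q *m e) i 0) * (Q *m e) i 0).
Proof.
rewrite AE -!mulmxA dotc_unitary ?trmxC_unitary // dotc_sum.
apply: eq_bigr => i _; rewrite !diag_mulE rmorphM /=.
rewrite conj_Creal ?ger0_real ?diag_ge0 //; ring.
Qed.

(** An eigenvector of A^* A with eigenvalue 0 lies in the kernel of A, which is orthogonal to the
    range of A^*. *)
Lemma range_diag0 (y : 'cV[C]_m) i :
  s 0 i = 0 -> (Q *m (A^t* *m y)) i 0 = 0.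
Proof.
move=> si0; have q0 : A *m (Q^t* *m (delta_mx i 0 : 'cV_n)) = 0.
  apply: dotc_eq0; rewrite dotc_mul_diag mulmxA (unitarymxP Qu) mul1mx.
  apply: big1 => j _; rewrite !mxE; case: (j =P i) => [->|_].
    by rewrite si0 mul0r.
  by rewrite !mulr0.
have -> : (Q *m (A^t* *m y)) i 0 = dotc (delta_mx i 0) (Q *m (A^t* *m y)).
  rewrite dotc_sum (bigD1 i) //= big1 => [|j ji].
    by rewrite [delta_mx _ _ _ _]mxE !eqxx conjC1 mul1r addr0.
  by rewrite [delta_mx _ _ _ _]mxE (negPf ji) conjC0 mul0r.
rewrite -[Q]trmxCK -dotc_adjoint -dotc_adjoint q0.
by rewrite /dotc trmx0 map_mx0 mul0mx mxE.
Qed.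

(** [eigenvalue] refers to row eigenvectors: any nonzero coordinate of [v *m Q^t*] singles out an
    index, and conversely the rows of [Q] are eigenvectors. *)
Lemma gram_eigenvalue (l : C) :
  reflect (exists i, s 0 i = l) (eigenvalue (A^t* *m A) l).
Proof.
apply: (iffP eigenvalueP) => [[v vE v0]|[i <-]].
  have /rV0Pn[i wi0] : v *m Q^t* != 0.
    apply: contra v0 => /eqP w0.
    by rewrite -(mulmxKtV v Qu erefl) w0 mul0mx.
  exists i; apply: (mulfI wi0).
  have : v *m Q^t* *m diag_mx s = l *: (v *m Q^t*).
    by rewrite scalemxAl -vE AE !mulmxA mulmxtVK.
  by move/rowP/(_ i); rewrite mul_mx_diag !mxE => ->; rewrite mulrC.
exists (row i Q); last first.
  apply/eqP => q0; have := congr1 (fun M : 'M[C]_n => M i i) (unitarymxP Qu).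
  rewrite mxE big1 => [|j _].
    by rewrite mxE eqxx => /esym/eqP; rewrite oner_eq0.
  have := congr1 (fun v : 'rV[C]_n => v 0 j) q0.
  by rewrite !mxE => ->; rewrite mul0r.
rewrite AE !mulmxA -row_mul (unitarymxP Qu) -mulmxA -row_mul mul1mx row_mul.
by rewrite row_diag_mx -scalemxAl -rowE.
Qed.

Lemma trace_gram : \tr (A^t* *m A) = \sum_i s 0 i.
Proof.
by rewrite AE mxtrace_mulC !mulmxA (unitarymxP Qu) mul1mx mxtrace_diag.
Qed.

Lemma trace_gram_sqr :
  \tr (A^t* *m A *m (A^t* *m A)) = \sum_i s 0 i ^+ 2.
Proof.
rewrite AE mulmxA mxtrace_mulC !mulmxA (unitarymxP Qu) mul1mx mulmxtVK //.
by rewrite mulmx_diag mxtrace_diag; apply: eq_bigr => i _; rewrite mxE expr2.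
Qed.

End Diagonalization.

Lemma gram_diagonalizable (C : numClosedFieldType) m n (A : 'M[C]_(m, n)) :
  exists (Q : 'M[C]_n) (s : 'rV_n),
    Q \is unitarymx /\ A^t* *m A = Q^t* *m diag_mx s *m Q.
Proof.
exists (spectralmx (A^t* *m A)), (spectral_diag (A^t* *m A)).
split; first exact: spectral_unitarymx.
rewrite -invmx_unitary ?spectral_unitarymx //; apply/orthomx_spectralP.
by apply/normalmxP; rewrite trmx_mul map_mxM trmxCK.
Qed.

(** * Independent choices and powers of the averaging operator *)

Section RandomIteration.
Variables (R : realType) (m : nat) (X : Type).
Local Notation I := ('I_m * 'I_m)%type.
Variables (step : I -> X -> X) (pr : I -> R).
Variables (d : measure_display) (T : measurableType d) (P : probability T R).
Variable S : nat -> T -> I.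
Hypothesis mS : forall k p, measurable (S k @^-1` [set p]).
Hypothesis prS : forall k p, P (S k @^-1` [set p]) = (pr p)%:E.
Hypothesis indS : mutually_independent P S.
Implicit Types (x : X) (s : nat -> I).

(** Convertible to [rk2_iter] when [step] is [rk2_step A b]. *)
Fixpoint iterate x s (k : nat) : X :=
  if k is k'.+1 then step (s k') (iterate x s k') else x.

(** The k-th power of the Markov operator applied to [g]. It peels off the first step, whereas
    [iterate] peels off the last. *)
Fixpoint iterate_mean (k : nat) (g : X -> R) x : R :=
  if k is k'.+1 then \sum_p pr p * iterate_mean k' g (step p x) else g x.

Definition cylinder s l : set T :=
  \bigcap_(k in [set` iota 0 l]) (S k @^-1` [set s k]).

Lemma cylinderP s l w : cylinder s l w <-> forall k, (k < l)%N -> S k w = s k.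
Proof.
split => [H k kl|H k]; first by apply: H; rewrite /= mem_iota.
by rewrite /= mem_iota add0n => /H.
Qed.

Lemma measurable_cylinder s l : measurable (cylinder s l).
Proof. by apply: fin_bigcap_measurable => // k _; exact: mS. Qed.

Lemma P_cylinder s l : P (cylinder s l) = (\prod_(k < l) pr (s k))%:E.
Proof.
rewrite /cylinder (indS (fun k => [set s k])) ?iota_uniq // -prodEFin.
rewrite -(big_mkord xpredT (fun k => (pr (s k))%:E)) /index_iota subn0.
by apply: eq_bigr => k _; rewrite prS.
Qed.

(** [X] carries no sigma-algebra: [B] can be arbitrary because each choice takes finitely many
    values. *)
Lemma measurable_iterate x k (B : set X) :
  measurable [set w | B (iterate x (S ^~ w) k)].
Proof.
elim: k B => [|k IH] B /=.
  have [Bx|Bx] := pselect (B x).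
    by rewrite (_ : [set _ | _] = setT) //; apply/seteqP; split.
  by rewrite (_ : [set _ | _] = set0) //; apply/seteqP; split.
rewrite (_ : [set _ | _] = \bigcup_p (S k @^-1` [set p] `&`
  [set w | B (step p (iterate x (S ^~ w) k))])); last first.
  by apply/seteqP; split => [w /= Bw|w [p _ /= [-> //]]]; exists (S k w).
apply: fin_bigcup_measurable => // p _; apply: measurableI; first exact: mS.
exact: (IH [set v | B (step p v)]).
Qed.

Lemma measurable_fun_iterate x k (g : X -> R) (D : set T) :
  measurable_fun D (fun w => g (iterate x (S ^~ w) k)).
Proof.
apply: measurable_funTS => _ B mB; rewrite setTI.
exact: (@measurable_iterate x k (g @^-1` B)).
Qed.

Lemma eq_iterate x s s' l :
  (forall k, (k < l)%N -> s k = s' k) -> iterate x s l = iterate x s' l.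
Proof.
elim: l => //= l IH ss'; rewrite ss' // IH // => k kl.
by apply: ss'; exact: ltnW.
Qed.

Definition extend s l p k : I := if k == l then p else s k.

Lemma iterate_extend x s l p :
  iterate x (extend s l p) l.+1 = step p (iterate x s l).
Proof.
rewrite /= {1}/extend eqxx; congr step; apply: eq_iterate => k kl.
by rewrite /extend ltn_eqF.
Qed.

Lemma cylinder_extend s l p :
  cylinder (extend s l p) l.+1 = cylinder s l `&` (S l @^-1` [set p]).
Proof.
apply/seteqP; split => [w /cylinderP H|w [/cylinderP H /= Sl]].
  split; last by rewrite /= H // /extend eqxx.
  apply/cylinderP => k kl; rewrite H; last exact: ltnW.
  by rewrite /extend ltn_eqF.
apply/cylinderP => k; rewrite ltnS leq_eqVlt /extend => /orP[/eqP ->|kl].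
  by rewrite eqxx.
by rewrite ltn_eqF // H.
Qed.

Lemma cylinder_bigsetU s l :
  cylinder s l = \big[setU/set0]_(p : I) cylinder (extend s l p) l.+1.
Proof.
rewrite -bigcup_seq; apply/seteqP; split => [w sw|w [p _]].
  by exists (S l w); rewrite /= ?mem_index_enum // cylinder_extend.
by rewrite cylinder_extend => -[].
Qed.

Lemma P_cylinder_extend s l p :
  P (cylinder (extend s l p) l.+1) = (P (cylinder s l) * (pr p)%:E)%E.
Proof.
rewrite !P_cylinder big_ord_recr /= EFinM {2}/extend eqxx; congr (_%:E * _)%E.
by apply: eq_bigr => k _; rewrite /extend ltn_eqF.
Qed.

(* Conditioning on the first [l] choices: the remaining [k] steps are averaged
   by the Markov operator of the iteration. *)
Lemma integral_cylinder x (g : X -> R) k s l : (forall x, 0 <= g x) ->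
  (\int[P]_(w in cylinder s l) (g (iterate x (S ^~ w) (l + k)))%:E =
   (iterate_mean k g (iterate x s l))%:E * P (cylinder s l))%E.
Proof.
move=> g0; elim: k s l => [|k IH] s l.
  rewrite addn0 -integral_cst; last exact: measurable_cylinder.
  apply: eq_integral => w; rewrite inE => /cylinderP sw.
  by rewrite (eq_iterate x sw).
(* The cylinder is split by the value of choice number [l]. Absorbing that choice turns [l + k.+1]
   into [l.+1 + k], where the induction hypothesis applies. *)
rewrite [in LHS]cylinder_bigsetU ge0_integral_bigsetU //=.
- rewrite -[in RHS](fineK (fin_num_measure P _ (measurable_cylinder s l))).
  rewrite -EFinM mulr_suml -sumEFin; apply: eq_bigr => p _.
  rewrite addnS -addSn IH iterate_extend P_cylinder_extend.
  rewrite -[in LHS](fineK (fin_num_measure P _ (measurable_cylinder s l))).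
  by rewrite -!EFinM; congr EFin; ring.
- by move=> p; exact: measurable_cylinder.
- exact: index_enum_uniq.
- move=> p q _ _ [w [/cylinderP wp /cylinderP wq]].
  by have := wp l (ltnSn l); rewrite wq // /extend eqxx.
- by apply/measurable_EFinP; exact: measurable_fun_iterate.
- by move=> w _; rewrite lee_fin.
Qed.

Lemma expectation_iterate x (g : X -> R) k : (forall x, 0 <= g x) ->
  ('E_P[fun w => g (iterate x (S ^~ w) k)] = (iterate_mean k g x)%:E)%E.
Proof.
move=> g0; rewrite unlock.
(* Even the empty cylinder needs some sequence of pairs. A sample point supplies one, and [T] is
   nonempty since it has probability 1. *)
have [w0 _] : exists w : T, True.
  apply: contrapT => noT.
  have := probability_setT P; rewrite (_ : setT = set0) ?measure0.
    by move=> /eqP; rewrite eqe eq_sym oner_eq0.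
  by apply/seteqP; split => // w _; case: noT; exists w.
have := @integral_cylinder x g k (S ^~ w0) 0 g0.
rewrite (_ : cylinder _ 0 = setT); last first.
  by apply/seteqP; split => // w _; apply/cylinderP.
by rewrite probability_setT mule1 add0n.
Qed.

End RandomIteration.

(** * Norms, largest singular value and [lambda_min] through the spectrum *)

Section SpectralBounds.
Variables (R : realType) (m n : nat) (A : 'M[R[i]]_(m, n)).
Local Notation D := (normF A ^+ 4 - normF (A *m A^t*) ^+ 2).
Hypothesis D_neq0 : D != 0.
Variables (Q : 'M[R[i]]_n) (r : 'I_n -> R).
Hypothesis Qu : Q \is unitarymx.
Hypothesis AE : A^t* *m A = Q^t* *m diag_mx (\row_i (r i)%:C) *m Q.

Lemma r_ge0 i : 0 <= r i.
Proof. by have := diag_ge0 Qu AE i; rewrite mxE ler0c. Qed.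

Lemma normF_spectrum : normF A ^+ 2 = \sum_i r i.
Proof.
apply: complexI; rewrite normF_trace (trace_gram Qu AE) rmorph_sum /=.
by apply: eq_bigr => i _; rewrite mxE.
Qed.

Lemma normF_gram_spectrum : normF (A *m A^t*) ^+ 2 = \sum_i r i ^+ 2.
Proof.
apply: complexI; rewrite normF_trace trmx_mul map_mxM trmxCK.
rewrite mulmxA mxtrace_mulC !mulmxA -mulmxA (trace_gram_sqr Qu AE) rmorph_sum /=.
by apply: eq_bigr => i _; rewrite mxE rmorphXn.
Qed.

Lemma eigenvalue_spectrum l :
  eigenvalue (A^t* *m A) l%:C <-> exists i, r i = l.
Proof.
split=> [/(gram_eigenvalue Qu AE _) [j]|[i <-]].
  by rewrite mxE => /complexI; exists j.
by apply/(gram_eigenvalue Qu AE _); exists i; rewrite mxE.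
Qed.

Lemma spectrum_neq0 : exists i, r i != 0.
Proof.
apply: contrapT => r0; move: D_neq0.
have {}r0 i : r i = 0 by apply/eqP/negPn/negP => ri; apply: r0; exists i.
rewrite (exprM _ 2 2 : normF A ^+ 4 = _) normF_spectrum normF_gram_spectrum.
rewrite !big1 => [|i _|i _]; rewrite ?r0 ?expr0n //=.
by rewrite subr0 eqxx.
Qed.

(** The infimum ranges over the finitely many nonzero [r i], of which [spectrum_neq0] provides one,
    so it is attained. *)
Lemma lambda_minE : exists2 i, r i != 0 & lambda_min A = r i /\
  forall j, r j != 0 -> r i <= r j.
Proof.
have [i0 ri0] := spectrum_neq0.
have [i ri rmin] := @arg_minP _ _ _ i0 (fun i => r i != 0) r ri0.
exists i => //; split => //.
have ilb : lbound [set l : R | l != 0 /\ eigenvalue (A^t* *m A) l%:C] (r i).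
  by move=> l [l0 /eigenvalue_spectrum[j rj]]; rewrite -rj in l0 *; exact: rmin.
have Ei : [set l : R | l != 0 /\ eigenvalue (A^t* *m A) l%:C] (r i).
  by split => //; apply/eigenvalue_spectrum; exists i.
apply/eqP; rewrite eq_le; apply/andP; split.
  by apply: ge_inf => //; exists (r i).
by apply: lb_le_inf => //; exists (r i).
Qed.

(** The singular values are the square roots of the [r i], so the supremum is the root of the
    largest one. *)
Lemma norm2E : exists i, norm2 A ^+ 2 = r i /\ forall j, r j <= r i.
Proof.
have [i0 _] := spectrum_neq0.
have [i _ rmax] := @arg_maxP _ _ _ i0 xpredT r isT.
exists i; split => [|j]; last exact: rmax.
suff -> : norm2 A = Num.sqrt (r i) by rewrite sqr_sqrtr // r_ge0.
have iub : ubound (singular_values A) (Num.sqrt (r i)).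
  move=> s [s0 /eigenvalue_spectrum[j rj]].
  by rewrite -[s](ger0_norm s0) -sqrtr_sqr -rj ler_sqrt ?r_ge0 //; exact: rmax.
have Si : singular_values A (Num.sqrt (r i)).
  split; first exact: sqrtr_ge0.
  by rewrite sqr_sqrtr ?r_ge0 //; apply/eigenvalue_spectrum; exists i.
apply/eqP; rewrite eq_le; apply/andP; split.
  by apply: ge_sup => //; exists (Num.sqrt (r i)).
by apply: ub_le_sup => //; exists (Num.sqrt (r i)).
Qed.

(** The weights are the squared moduli of the coordinates of [e] in the eigenbasis. They reduce
    inequalities between the three norms to termwise ones. *)
Lemma range_spectrum (y : 'cV[R[i]]_m) (e := A^t* *m y) :
  exists w : 'I_n -> R,
    [/\ forall i, 0 <= w i, forall i, r i = 0 -> w i = 0,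
        normF e ^+ 2 = \sum_i w i,
        normF (A *m e) ^+ 2 = \sum_i r i * w i &
        normF (A^t* *m A *m e) ^+ 2 = \sum_i r i ^+ 2 * w i].
Proof.
exists (fun i => Normc.normc ((Q *m e) i 0) ^+ 2).
have wE i : (Normc.normc ((Q *m e) i 0) ^+ 2)%:C =
    Num.conj ((Q *m e) i 0) * (Q *m e) i 0 by rewrite normc_sqrE mulrC.
split => [i|i ri|||].
- exact: sqr_ge0.
- by rewrite (range_diag0 Qu AE) ?mxE ?ri // Normc.normc0 expr0n.
- apply: complexI; rewrite dotcE -(dotc_unitary _ _ Qu) dotc_sum rmorph_sum /=.
  by apply: eq_bigr => i _; rewrite wE.
- apply: complexI; rewrite dotcE (dotc_mul_diag AE) rmorph_sum /=.
  by apply: eq_bigr => i _; rewrite rmorphM /= wE mxE.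
- apply: complexI; rewrite dotcE (dotc_gram_diag Qu AE) rmorph_sum /=.
  by apply: eq_bigr => i _; rewrite rmorphM rmorphXn /= wE mxE.
Qed.

End SpectralBounds.

Lemma normF0 (R : realType) m n : normF (0 : 'M[R[i]]_(m, n)) = 0.
Proof.
rewrite /normF big1 ?sqrtr0 // => i _.
by rewrite big1 // => j _; rewrite mxE Normc.normc0 expr0n.
Qed.

(** * The contraction factor and mean-square convergence *)

Section Contraction.
Variables (R : realType) (m n : nat) (A : 'M[R[i]]_(m, n)).
Local Notation D := (normF A ^+ 4 - normF (A *m A^t*) ^+ 2).
Hypothesis D_neq0 : D != 0.

Lemma real_gram_diagonalizable :
  exists (Q : 'M[R[i]]_n) (r : 'I_n -> R), Q \is unitarymx /\
    A^t* *m A = Q^t* *m diag_mx (\row_i (r i)%:C) *m Q.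
Proof.
have [Q [s [Qu AE]]] := gram_diagonalizable A.
exists Q, (fun i => complex.Re (s 0 i)); split => //; rewrite {1}AE.
congr (_ *m diag_mx _ *m _); apply/rowP => i.
by rewrite mxE RRe_real // ger0_real // (diag_ge0 Qu AE).
Qed.

Lemma lambda_min_gt0 : 0 < lambda_min A.
Proof.
have [Q [r [Qu AE]]] := real_gram_diagonalizable.
have [i ri [-> _]] := lambda_minE D_neq0 Qu AE.
by rewrite lt0r ri (r_ge0 Qu AE).
Qed.

Lemma lambda_min_range (y : 'cV[R[i]]_m) (e := A^t* *m y) :
  lambda_min A * normF e ^+ 2 <= normF (A *m e) ^+ 2.
Proof.
have [Q [r [Qu AE]]] := real_gram_diagonalizable.
have [i ri [-> rmin]] := lambda_minE D_neq0 Qu AE.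
have [w [w0 rw -> -> _]] := range_spectrum Qu AE y.
rewrite mulr_sumr; apply: ler_sum => j _.
(* The lower bound on eigenvalues fails for zero ones, but there [e] has no component. *)
have [/rw ->|rj] := eqVneq (r j) 0; first by rewrite !mulr0.
by apply: ler_wpM2r => //; exact: rmin.
Qed.

Lemma norm2_range (y : 'cV[R[i]]_m) (e := A^t* *m y) :
  normF (A^t* *m A *m e) ^+ 2 <= norm2 A ^+ 2 * normF (A *m e) ^+ 2.
Proof.
have [Q [r [Qu AE]]] := real_gram_diagonalizable.
have [i [-> rmax]] := norm2E D_neq0 Qu AE.
have [w [w0 _ _ -> ->]] := range_spectrum Qu AE y.
rewrite mulr_sumr; apply: ler_sum => j _.
rewrite expr2 -mulrA; apply: ler_wpM2r; last exact: rmax.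
by rewrite mulr_ge0 // (r_ge0 Qu AE).
Qed.

Lemma D_gt0 : 0 < D.
Proof.
by rewrite lt0r D_neq0 -sum_cross sumr_ge0 // => p _; exact: sqr_ge0.
Qed.

Lemma normF_gt0 : 0 < normF A ^+ 2.
Proof.
rewrite lt0r sqr_ge0 andbT; apply/eqP => /normF_eq0 A0.
by move: D_gt0; rewrite A0 mul0mx !normF0 !expr0n subrr ltxx.
Qed.

(* With [F = |A|_F^2], [s = |A|_2^2] and [G = |A A^*|_F^2]:
   2F^2 - 2Fs - (F^2 - G) = (F - s)^2 + (G - s^2), and G >= s^2. *)
Lemma gap_gt : D < 2 * normF A ^+ 4 - 2 * normF A ^+ 2 * norm2 A ^+ 2.
Proof.
have [Q [r [Qu AE]]] := real_gram_diagonalizable.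
have [i [-> _]] := norm2E D_neq0 Qu AE.
have Gri : r i ^+ 2 <= normF (A *m A^t*) ^+ 2.
  rewrite (normF_gram_spectrum Qu AE) (bigD1 i) //= lerDl.
  by rewrite sumr_ge0 // => j _; exact: sqr_ge0.
have := D_gt0.
rewrite (exprM _ 2 2 : normF A ^+ 4 = _).
move: (normF A ^+ 2) (normF (A *m A^t*) ^+ 2) (r i) Gri => F G s Gs D0.
(* If F = s, then G >= s^2 = F^2 contradicts D > 0; otherwise (F - s)^2 makes the inequality
   strict. *)
have [Fs|Fs] := eqVneq F s; first by rewrite Fs in D0; lra.
have : 0 < (F - s) ^+ 2 by rewrite exprn_even_gt0 //= subr_eq0.
by rewrite sqrrB; lra.
Qed.

Lemma rk2_factor_lt : rk2_factor A < rk_factor A.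
Proof.
rewrite /rk2_factor /rk_factor ltrD2l ltrN2 -[ltLHS]mul1r ltr_pM2r.
  by rewrite ltr_pdivlMr ?D_gt0 // mul1r gap_gt.
by rewrite divr_gt0 ?lambda_min_gt0 ?normF_gt0.
Qed.

Lemma rk2_factor_lt1 : rk2_factor A < 1.
Proof.
apply: lt_trans rk2_factor_lt _; rewrite /rk_factor gtrDl oppr_lt0.
by rewrite divr_gt0 ?lambda_min_gt0 ?normF_gt0.
Qed.

Variables (b : 'cV[R[i]]_m) (z : 'cV[R[i]]_n).
Hypothesis Az : A *m z = b.

Lemma rk2_prob_ge0 p : 0 <= rk2_prob A p.
Proof. by rewrite divr_ge0 ?sqr_ge0 // ltW ?D_gt0. Qed.

Lemma mean_rk2_step_le x y : x - z = A^t* *m y ->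
  \sum_p rk2_prob A p * normF (rk2_step A b p x - z) ^+ 2 <=
  rk2_factor A * normF (x - z) ^+ 2.
Proof.
move=> xzE; rewrite (mean_rk2_step x Az D_neq0) xzE.
have := lambda_min_range y; have := norm2_range y; have := gap_gt.
have := D_gt0; have := normF_gt0.
rewrite /rk2_factor (exprM _ 2 2 : normF A ^+ 4 = _).
move: (normF (A^t* *m A *m _) ^+ 2) (normF (A *m (_ *m _)) ^+ 2).
move: (normF (A^t* *m y) ^+ 2).
move: (normF A ^+ 2) (normF (A *m A^t*) ^+ 2) (norm2 A ^+ 2) (lambda_min A).
move=> F G s l E V U F0 D0 gap VU lU.
(* By the gap, 2 F (F - s) exceeds D > 0. The sign of F - s is what allows the lower bound on |A
   e|^2 to be used below. *)
have sF : s < F.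
  have : 0 < 2 * F * (F - s) by lra.
  by rewrite pmulr_rgt0 ?mulr_gt0 //; lra.
have -> : (1 - (2 * F ^+ 2 - 2 * F * s) / (F ^+ 2 - G) * (l / F)) * E =
   E - (2 * (F - s) * (l * E)) / (F ^+ 2 - G).
  by field; rewrite !gt_eqF.
rewrite lerD2l lerN2 ler_pM2r ?invr_gt0 //.
(* The lower half uses |A e|^2 >= lambda_min |e|^2, the upper half |A^* A e|^2 <= |A|_2^2 |A
   e|^2. *)
apply: (@le_trans _ _ (2 * (F - s) * U)); last by lra.
by rewrite ler_pM2l // mulr_gt0 // subr_gt0.
Qed.

(** A step adds a combination of adjoint rows, which are the columns of A^*. *)
Lemma rk2_step_range p x y : x - z = A^t* *m y ->
  exists y', rk2_step A b p x - z = A^t* *m y'.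
Proof.
pose u i : 'cV[R[i]]_m := (delta_mx 0 i : 'rV_m)^t*.
have rowT i : (row i A)^t* = A^t* *m u i by rewrite rowE trmx_mul map_mxM.
move=> xzE.
exists (y + rk2_coef A b p.1 p.2 x *: u p.1 + rk2_coef A b p.2 p.1 x *: u p.2).
rewrite !mulmxDr -!scalemxAr -xzE -!rowT /rk2_step.
move: (rk2_coef A b p.1 p.2 x) (rk2_coef A b p.2 p.1 x) => c1 c2.
by rewrite addrAC [X in X + _]addrAC.
Qed.

(** The one-step bound itself gives the sign: for a nonzero error e in the range of A^*, a mean of
    squares is at most the factor times |e|^2. *)
Lemma rk2_factor_ge0 : 0 <= rk2_factor A.
Proof.
have [y Ay] : exists y : 'cV[R[i]]_m, 0 < normF (A^t* *m y) ^+ 2.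
  apply: contrapT => noy; have := normF_gt0.
  rewrite -normF_adjoint (_ : A^t* = 0) ?normF0 ?expr0n ?ltxx //.
  apply/matrixP => i j; apply/eqP/negPn/negP => Aij.
  apply: noy; exists (delta_mx j 0); rewrite -colE lt0r sqr_ge0 andbT.
  apply/eqP => /normF_eq0 /matrixP/(_ i 0).
  by rewrite [LHS]mxE [RHS]mxE => Aij0; rewrite Aij0 mxE eqxx in Aij.
have e0 : (z + A^t* *m y) - z = A^t* *m y by rewrite addrC addKr.
have := mean_rk2_step_le e0; rewrite e0 -(pmulr_lge0 _ Ay).
apply: le_trans; apply: sumr_ge0 => p _.
by rewrite mulr_ge0 ?rk2_prob_ge0 ?sqr_ge0.
Qed.

(** One factor pays for the first step; the other k come from the induction hypothesis at each
    outcome of that step, whose error is still in the range of A^*. *)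
Lemma iterate_mean_bounds k x y : x - z = A^t* *m y ->
  0 <= iterate_mean (rk2_step A b) (rk2_prob A) k
         (fun v => normF (v - z) ^+ 2) x
    <= rk2_factor A ^+ k * normF (x - z) ^+ 2.
Proof.
elim: k x y => [|k IH] x y xzE /=; first by rewrite mul1r sqr_ge0 lexx.
apply/andP; split.
  apply: sumr_ge0 => p _; rewrite mulr_ge0 ?rk2_prob_ge0 //.
  by have [y' /IH /andP[]] := rk2_step_range p xzE.
rewrite exprSr -mulrA.
apply: le_trans (ler_wpM2l _ (mean_rk2_step_le xzE)); last first.
  by rewrite exprn_ge0 // rk2_factor_ge0.
rewrite mulr_sumr; apply: ler_sum => p _; rewrite mulrCA.
apply: ler_wpM2l; first exact: rk2_prob_ge0.
by have [y' /IH /andP[]] := rk2_step_range p xzE.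
Qed.

Variables (d : measure_display) (T : measurableType d) (P : probability T R).
Variable S : nat -> T -> 'I_m * 'I_m.
Hypothesis sampling : rk2_sampling A P S.

Lemma mean_square_errorE x0 k :
  mean_square_error A b P S x0 z k =
  (iterate_mean (rk2_step A b) (rk2_prob A) k
     (fun v => normF (v - z) ^+ 2) x0)%:E.
Proof.
have [mS prS indS] := sampling.
exact: (expectation_iterate (rk2_step A b) mS prS indS x0 k
  (fun v => sqr_ge0 (normF (v - z)))).
Qed.

Lemma rk2_convergence x0 : (exists y, x0 - z = A^t* *m y) ->
  mean_square_cvg A b P S x0 z /\
  mean_square_bound A b P S (rk2_factor A) x0 z.
Proof.
move=> [y xzE]; split => [|k]; last first.
  rewrite mean_square_errorE lee_fin.
  by have /andP[] := iterate_mean_bounds k.+1 xzE.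
rewrite /mean_square_cvg.
under eq_fun do rewrite mean_square_errorE.
apply/cvg_EFin; first by near=> k.
apply: (@squeeze_cvgr _ _ _ _ (cst 0)
  (fun k => rk2_factor A ^+ k * normF (x0 - z) ^+ 2)).
- by near=> k; exact: iterate_mean_bounds xzE.
- exact: cvg_cst.
rewrite -(mul0r (normF (x0 - z) ^+ 2)); apply: cvgM; last exact: cvg_cst.
apply: cvg_expr.
by rewrite ger0_norm ?rk2_factor_ge0 ?rk2_factor_lt1.
Unshelve. all: by end_near.
Qed.

End Contraction.

(** The steps never change the component of [x0] in the kernel of A. So the limit is [xstar] when
    [x0] lies in the range of A^*, and in general [xstar] plus that kernel component, the orthogonal
    projection of [x0] onto the solution set. *)
Theorem theorem3p3 (R : realType) (m n : nat)
    (A : 'M[R[i]]_(m, n)) (b : 'cV[R[i]]_m)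
    (Adag : 'M[R[i]]_(n, m)) (xstar : 'cV[R[i]]_n)
    (d : measure_display) (T : measurableType d) (P : probability T R)
    (S : nat -> T -> 'I_m * 'I_m)
    (consistent : exists x : 'cV[R[i]]_n, A *m x = b)
    (normF_neq : normF A ^+ 4 <> normF (A *m A^t*) ^+ 2)
    (AdagP : is_pseudoinverse A Adag)
    (xstarE : xstar = Adag *m b)
    (sampling : rk2_sampling A P S) :
  [/\ forall x0 : 'cV[R[i]]_n, (exists y : 'cV[R[i]]_m, x0 = A^t* *m y) ->
        mean_square_cvg A b P S x0 xstar /\
        mean_square_bound A b P S (rk2_factor A) x0 xstar,
      forall x0 : 'cV[R[i]]_n,
        let z := xstar + (1%:M - Adag *m A) *m x0 in
        mean_square_cvg A b P S x0 z /\
        mean_square_bound A b P S (rk2_factor A) x0 z &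
      rk2_factor A < rk_factor A].
Proof.
have D_neq0 : normF A ^+ 4 - normF (A *m A^t*) ^+ 2 != 0.
  by rewrite subr_eq0; apply/eqP.
have [AAdA AdAAd _ AdAJ] := AdagP.
have [x Ax] := consistent.
have Axstar : A *m xstar = b by rewrite xstarE -Ax !mulmxA AAdA.
(* By the Penrose equations, Adag = Adag A Adag with Adag A Hermitian, so the range of [Adag] lies
   in that of A^*. *)
have AdagE : Adag = A^t* *m (Adag^t* *m Adag).
  by rewrite mulmxA -map_mxM -trmx_mul AdAJ AdAAd.
split; last exact: rk2_factor_lt.
- move=> x0 [y x0E]; apply: (rk2_convergence D_neq0 Axstar sampling).
  exists (y - Adag^t* *m Adag *m b).
  by rewrite mulmxBr mulmxA -AdagE x0E xstarE.
- move=> x0 z; apply: (rk2_convergence D_neq0 _ sampling).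
    by rewrite mulmxDr Axstar mulmxA mulmxBr mulmx1 mulmxA AAdA subrr mul0mx addr0.
  (* Here x0 - z = Adag (A x0 - b), and [AdagE] exhibits it in the range of A^*. *)
  exists (Adag^t* *m Adag *m (A *m x0 - b)).
  rewrite mulmxA -AdagE /z xstarE mulmxBl mul1mx mulmxBr opprD opprB.
  by rewrite addrCA [x0 + _]addrC subrK addrC mulmxA.
Qed.
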